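(* Let $(\mathcal{G},\tau_1)$ be a Hausdorff topological $\widetilde{\mathbb{C}}$-module with the property that every weakly singular $\widetilde{\mathbb{C}}$-linear map from $(\mathcal{G},\tau_1)$ onto a barrelled topological $\widetilde{\mathbb{C}}$-module is open. Then $(\mathcal{G},\tau_1)$ is an s-$\widetilde{\mathbb{C}}$-module.
   Context: ''Coarser'' and ''finer'' are meant non-strictly; $\tau\prec\tau'$ means that $\tau$ is coarser than $\tau'$. Generalized numbers: $\widetilde{\mathbb{C}}=\mathcal{E}_M/\mathcal{N}$, where $\mathcal{E}_M$ is the ring of nets $(c_\varepsilon)_\varepsilon\in\mathbb{C}^{(0,1]}$ with $|c_\varepsilon|=O(\varepsilon^{-N})$ as $\varepsilon\to0$ for some $N\in\mathbb{N}$, and $\mathcal{N}$ is the ideal of nets with $|c_\varepsilon|=O(\varepsilon^{q})$ for all $q\in\mathbb{N}$; $[(c_\varepsilon)_\varepsilon]$ denotes the class of $(c_\varepsilon)_\varepsilon$. The valuation is $\mathrm{v}(c)=\sup\{b\in\mathbb{R}: |c_\varepsilon|=O(\varepsilon^b)\text{ as }\varepsilon\to0\}$ and $|c|_{\mathrm e}=e^{-\mathrm{v}(c)}$; $\widetilde{\mathbb{C}}$ carries the topology of the ultrametric $|c-d|_{\mathrm e}$. A topological $\widetilde{\mathbb{C}}$-module is a $\widetilde{\mathbb{C}}$-module with a $\widetilde{\mathbb{C}}$-linear topology, i.e. one making addition and scalar multiplication $\widetilde{\mathbb{C}}\times\mathcal{G}\to\mathcal{G}$ continuous. A subset $A$ of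 a $\widetilde{\mathbb{C}}$-module $\mathcal{G}$ is balanced if $\lambda A\subseteq A$ whenever $|\lambda|_{\mathrm e}\le1$; absorbent if for every $u\in\mathcal{G}$ there is $a\in\mathbb{R}$ with $u\in[(\varepsilon^b)_\varepsilon]A$ for all $b\le a$. A string in $\mathcal{G}$ is a sequence $(U_n)_{n\ge1}$ of balanced and absorbent subsets of $\mathcal{G}$ (its knots) with $U_{n+1}+U_{n+1}\subseteq U_n$ for all $n$ and $[(\varepsilon^{-n})_\varepsilon]U_{n+p}\subseteq U_p$ for all $n,p\ge1$. In a topological $\widetilde{\mathbb{C}}$-module a string is closed if every knot is closed, and topological if every knot is a neighborhood of $0$. A topological $\widetilde{\mathbb{C}}$-module (or its topology) is barrelled if every closed string in it is topological. For a $\widetilde{\mathbb{C}}$-linear topology $\tau$ on a $\widetilde{\mathbb{C}}$-module, the associated barrelled topology $\tau^t$ is the coarsest barrelled $\widetilde{\mathbb{C}}$-linear topology finer than $\tau$ (it exists). A Hausdorff topological $\widetilde{\mathbb{C}}$-module $(\mathcal{H},\tau_0)$ is an infra-s $\widetilde{\mathbb{C}}$-module if for every Hausdorff $\widetilde{\mathbb{C}}$-linear topology $\tau$ on $\mathcal{H}$ coarser than $\tau_0$ one has $\tau_0\prec\tau^t$. A Hausdorff topological $\widetilde{\mathbb{C}}$-module $(\mathcal{G},\tau)$ is an s-$\widetilde{\mathbb{C}}$-module if for every closed $\widetilde{\mathbb{C}}$-submodule $M$ the quotient $\mathcal{G}/M$ with the quotient topology is an infra-s $\widetilde{\mathbb{C}}$-module.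 A $\widetilde{\mathbb{C}}$-linear map $T:\mathcal{G}\to\mathcal{F}$ between topological $\widetilde{\mathbb{C}}$-modules (not assumed continuous) is weakly singular if $\bigcap_{V}\overline{T^{-1}(V)}=\overline{\mathrm{Ker}(T)}$, the intersection being over all neighborhoods $V$ of $0$ in $\mathcal{F}$ and closures being taken in $\mathcal{G}$. *)

(* Defs.v *)
From HB Require Import structures.
From mathcomp Require Import all_boot all_order all_algebra.
From mathcomp Require Import generic_quotient ring_quotient.
From mathcomp Require Import complex.
From mathcomp Require Import all_classical all_reals all_analysis.
Set Implicit Arguments.
Unset Strict Implicit.
Unset Printing Implicit Defensive.
Import Order.TTheory GRing.Theory Num.Theory.
Import numFieldNormedType.Exports.
Local Open Scope classical_set_scope.
Local Open Scope ring_scope.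
Local Open Scope complex_scope.
Local Open Scope quotient_scope.

Section Nets.
Variable R : realType.

Definition eps_index : Type := {e : R | 0 < e <= 1}.
HB.instance Definition _ := Choice.on eps_index.

(* A base point is what makes the ring of nets nontrivial. *)
Lemma eps_index1_subproof : 0 < (1 : R) <= 1.
Proof. by rewrite ltr01 lexx. Qed.
HB.instance Definition _ := isPointed.Build eps_index (exist _ 1 eps_index1_subproof).

Local Notation net := (eps_index -> R[i]).

(* |c_eps| = O(eps^b) as eps -> 0 *)
Definition bigO_pow (c : net) (b : R) : Prop :=
  exists K eta : R, 0 < eta /\
    forall e : eps_index, val e < eta -> Normc.normc (c e) <= K * (val e) `^ b.

Lemma bigO_powP (c : net) b : bigO_pow c b ->
  exists K eta : R, [/\ 0 <= K, 0 < eta &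
    forall e : eps_index, val e < eta -> Normc.normc (c e) <= K * (val e) `^ b].
Proof.
move=> [K [eta [eta0 H]]]; exists `|K|, eta; split=> // e /H /le_trans; apply.
by rewrite ler_wpM2r ?powR_ge0// ler_norm.
Qed.

Lemma bigO_pow_le (c : net) b b' : b' <= b -> bigO_pow c b -> bigO_pow c b'.
Proof.
move=> bb /bigO_powP[K [eta [K0 eta0 H]]]; exists K, eta; split=> // e /H.
move=> /le_trans; apply; rewrite ler_wpM2l//.
by apply: ger_powR => //; exact: (valP e).
Qed.

Lemma bigO_powN (c : net) b : bigO_pow c b -> bigO_pow (- c) b.
Proof.
move=> [K [eta [eta0 H]]]; exists K, eta; split=> // e /H.
by rewrite (normcN (c e)).
Qed.

Lemma bigO_powD (c d : net) b :
  bigO_pow c b -> bigO_pow d b -> bigO_pow (c + d) b.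
Proof.
move=> [K [eta [eta0 H]]] [L [eta' [eta'0 H']]].
exists (K + L), (Num.min eta eta'); split; first by rewrite lt_min eta0.
move=> e; rewrite lt_min => /andP[/H h /H' h'].
by rewrite mulrDl (le_trans (le_normcD (c e) (d e)))// lerD.
Qed.

Lemma bigO_powM (c d : net) a b :
  bigO_pow c a -> bigO_pow d b -> bigO_pow (c * d) (a + b).
Proof.
move=> /bigO_powP[K [eta [K0 eta0 H]]] /bigO_powP[L [eta' [L0 eta'0 H']]].
exists (K * L), (Num.min eta eta'); split; first by rewrite lt_min eta0.
move=> e; rewrite lt_min => /andP[/H h /H' h'].
have e0 : val e != 0 by case/andP: (valP e) => /gt_eqF ->.
rewrite powRD ?e0 ?implybT// mulrACA [leLHS](_ : _ =
  Normc.normc (c e) * Normc.normc (d e)); last exact: Normc.normcM.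
by apply: ler_pM => //; rewrite /Normc.normc; case: (_ e) => *; exact: sqrtr_ge0.
Qed.

Lemma bigO_pow0 b : bigO_pow 0 b.
Proof.
exists 0, 1; split=> // e _; rewrite mul0r.
by rewrite [leLHS](_ : _ = 0)// Normc.normc0.
Qed.

Lemma bigO_pow1 : bigO_pow 1 0.
Proof.
exists 1, 1; split=> // e _; rewrite powRr0 mulr1.
by rewrite [leLHS](_ : _ = 1)// Normc.normc1.
Qed.

Lemma bigO_pow1N b : 0 < b -> ~ bigO_pow 1 b.
Proof.
move=> b0 /bigO_powP[K [eta [K0 eta0 H]]].
have K1 : 0 < K + 1 by rewrite ltr_wpDl.
pose t : R := (K + 1)^-1 `^ b^-1.
have t0 : 0 < t by rewrite powR_gt0// invr_gt0.
pose e : R := Num.min (Num.min (eta / 2) t) 1.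
have eP : 0 < e <= 1 by rewrite /e !lt_min ge_min lexx orbT !divr_gt0// t0 ltr01.
have /H : val (exist _ e eP : eps_index) < eta.
  rewrite /= /e !gt_min; apply/orP; left; apply/orP; left.
  by rewrite ltr_pdivrMr// ltr_pMr// ltr1n.
apply/negP; rewrite -ltNge [ltRHS](_ : _ = 1); last exact: Normc.normc1.
have e0 : 0 <= e by case/andP: eP => /ltW.
apply: (@le_lt_trans _ _ (K * t `^ b)).
  rewrite ler_wpM2l//; apply: ge0_ler_powR; rewrite ?nnegrE ?(ltW b0)//=.
  - exact: ltW.
  - by rewrite /e ge_min ge_min lexx orbT.
rewrite -powRrM mulVf ?gt_eqF// powRr1 ?invr_ge0 ?ltW//.
by rewrite ltr_pdivrMr// mul1r ltrDl.
Qed.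

Definition moderate (c : net) : bool := `[< exists N : nat, bigO_pow c (- N%:R) >].

Lemma moderate_subring : subring_closed moderate.
Proof.
split.
- by apply/asboolP; exists 0%N; rewrite oppr0; exact: bigO_pow1.
- move=> c d /asboolP[N cN] /asboolP[M dM]; apply/asboolP; exists (N + M)%N.
  apply: bigO_powD; [apply: bigO_pow_le cN|apply: bigO_pow_le (bigO_powN dM)].
  + by rewrite lerN2 ler_nat leq_addr.
  + by rewrite lerN2 ler_nat leq_addl.
- move=> c d /asboolP[N cN] /asboolP[M dM]; apply/asboolP; exists (N + M)%N.
  by rewrite natrD opprD; exact: bigO_powM.
Qed.
HB.instance Definition _ :=
  GRing.isSubringClosed.Build net moderate moderate_subring.

(* the ring E_M *)
Definition moderate_net : Type := {c : net | moderate c}.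
HB.instance Definition _ := SubChoice.on moderate_net.
HB.instance Definition _ := [SubChoice_isSubComNzRing of moderate_net by <:].

(* the ideal N of E_M *)
Definition negligible (c : moderate_net) : bool :=
  `[< forall q : nat, bigO_pow (val c) q%:R >].

Lemma negligible_ideal : idealr_closed negligible.
Proof.
split.
- by apply/asboolP => q; exact: bigO_pow0.
- by apply/asboolPn => /(_ 1%N); apply: bigO_pow1N.
- move=> a c d /asboolP cq /asboolP dq; apply/asboolP => q.
  have /asboolP[N aN] := valP a.
  apply: bigO_powD; last exact: dq.
  have := bigO_powM aN (cq (N + q)%N).
  by rewrite natrD addrA addNr add0r.
Qed.
HB.instance Definition _ := isIdealr.Build moderate_net negligible negligible_ideal.

Definition gennum : Type := {ideal_quot (negligible : idealr moderate_net)}.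
HB.instance Definition _ := GRing.ComNzRing.on gennum.
HB.instance Definition _ := EqQuotient.on gennum.

Definition valuation (x : gennum) : \bar R :=
  ereal_sup [set b%:E | b in [set b | bigO_pow (val (repr x)) b]].

Lemma valuation_pi (c : moderate_net) :
  valuation (\pi c) = ereal_sup [set b%:E | b in [set b | bigO_pow (val c) b]].
Proof.
suff H (d d' : moderate_net) : negligible (d - d') ->
    [set b | bigO_pow (val d') b] `<=` [set b | bigO_pow (val d) b].
  have n1 : negligible (c - repr (\pi_gennum c)).
    by have := Quotient.idealrBE (negligible : idealr _) c (repr (\pi_gennum c));
      rewrite reprK eqxx.
  have n2 : negligible (repr (\pi_gennum c) - c).
    by have := Quotient.idealrBE (negligible : idealr _) (repr (\pi_gennum c)) c;
      rewrite reprK eqxx.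
  by rewrite /valuation; congr (ereal_sup (image _ _)); apply/seteqP; split;
    exact: H.
move=> /asboolP n b /= d'b; rewrite -(subrK d' d).
apply: bigO_powD => //.
apply: bigO_pow_le (n (Num.truncn `|b|).+1).
by rewrite (le_trans (ler_norm b))// ltW// truncnS_gt.
Qed.

Lemma valuation_ge (x : gennum) b :
  bigO_pow (val (repr x)) b -> (b%:E <= valuation x)%E.
Proof. by move=> xb; apply: ereal_sup_ubound; exists b. Qed.

Lemma valuation_gt (x : gennum) b :
  (b%:E < valuation x)%E -> bigO_pow (val (repr x)) b.
Proof.
move=> /ereal_sup_gt[_ [b' /= xb' <-]]; rewrite lte_fin => /ltW bb'.
exact: bigO_pow_le xb'.
Qed.

Lemma valuation_gtNy (x : gennum) : (-oo < valuation x)%E.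
Proof.
have /asboolP[N /valuation_ge] := valP (repr x).
by apply: lt_le_trans; rewrite ltNyr.
Qed.

Lemma valuationN (x : gennum) : valuation (- x) = valuation x.
Proof.
rewrite -[x]reprK -(rmorphN \pi_gennum) !valuation_pi.
congr (ereal_sup (image _ _)); apply/seteqP; split => b /= H.
  by rewrite -[_ (repr x)]opprK; exact: bigO_powN.
exact: bigO_powN.
Qed.

Lemma valuationD (x y : gennum) :
  (Order.min (valuation x) (valuation y) <= valuation (x + y)%R)%E.
Proof.
rewrite leNgt; apply/negP => lt_xy.
have [b xyb bm] : exists2 b, (valuation (x + y)%R < b%:E)%E &
    (b%:E < Order.min (valuation x) (valuation y))%E.
  have := valuation_gtNy (x + y).
  case: (valuation (x + y)) lt_xy => [r| |]//.
    case: (Order.min _ _) => [s| |]// rs _.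
      exists ((r + s) / 2); rewrite !lte_fin in rs *.
        by rewrite midf_lt.
      by rewrite midf_lt.
    by exists (r + 1); rewrite ?ltry// lte_fin ltrDl.
  by rewrite ltNge leey.
move: bm; rewrite lt_min => /andP[/valuation_gt xb /valuation_gt yb].
move: xyb; rewrite ltNge => /negP; apply.
have xyb := bigO_powD xb yb.
rewrite -[in X in valuation X](reprK x) -[in X in valuation X](reprK y).
rewrite -(rmorphD \pi_gennum) valuation_pi.
by apply: ereal_sup_ubound; exists b.
Qed.

(* |x|_e *)
Definition enorm (x : gennum) : R := fine (expeR (- valuation x)%E).

Lemma enorm_ge0 x : 0 <= enorm x.
Proof. by rewrite fine_ge0// expeR_ge0. Qed.

Lemma enormN x : enorm (- x) = enorm x.
Proof. by rewrite /enorm valuationN. Qed.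

Lemma enorm0 : enorm 0 = 0.
Proof.
rewrite /enorm; suff -> : valuation 0 = +oo%E by [].
rewrite -(rmorph0 \pi_gennum) valuation_pi; apply/eqyP => r r0.
by apply: ereal_sup_ubound; exists r => //; exact: bigO_pow0.
Qed.

Lemma enorm_eq0 x : enorm x = 0 -> x = 0.
Proof.
have := valuation_gtNy x; rewrite /enorm.
case E : (valuation x) => [r| |]//= _; first by move/eqP; rewrite expR_eq0.
move=> _; rewrite -[x]reprK -(rmorph0 \pi_gennum).
apply/eqP; rewrite -Quotient.idealrBE subr0; apply/asboolP => q.
by apply: valuation_gt; rewrite E ltry.
Qed.

Lemma enorm_le x y : (valuation y <= valuation x)%E -> enorm x <= enorm y.
Proof.
have := valuation_gtNy x; have := valuation_gtNy y; rewrite /enorm.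
case: (valuation x) => [r| |]; case: (valuation y) => [s| |]//= _ _.
by rewrite lee_fin => sr; rewrite ler_expR lerN2.
Qed.

Lemma enormD x y : enorm (x + y) <= Num.max (enorm x) (enorm y).
Proof.
rewrite le_max; have := valuationD x y.
by rewrite minElt; case: ifP => _ h; rewrite (enorm_le h) ?orbT.
Qed.

Lemma edist_triangle (y x z : gennum) :
  enorm (x - z) <= enorm (x - y) + enorm (y - z).
Proof.
rewrite -[x - z](subrKA y).
apply: (le_trans (enormD _ _)).
by rewrite ge_max lerDl lerDr !enorm_ge0.
Qed.

HB.instance Definition _ := isMetric.Build R gennum
  (mdist := fun x y => enorm (x - y))
  (fun x => etrans (congr1 enorm (subrr x)) enorm0)
  (fun x y h => subr0_eq (enorm_eq0 h))
  (fun x y => etrans (esym (enormN (x - y))) (congr1 enorm (opprB x y)))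
  edist_triangle.

Lemma normc_eps_pow b (e : eps_index) :
  Normc.normc ((val e `^ b)%:C) = val e `^ b.
Proof. by rewrite /= expr0n/= addr0 sqrtr_sqr ger0_norm// powR_ge0. Qed.

Lemma eps_pow_moderate b : moderate (fun e : eps_index => (val e `^ b)%:C).
Proof.
apply/asboolP; exists (Num.truncn `|b|).+1.
apply: (@bigO_pow_le _ b).
  by rewrite lerNl (le_trans (ler_norm (- b)))// normrN ltW// truncnS_gt.
by exists 1, 1; split=> // e _; rewrite normc_eps_pow mul1r.
Qed.

(* the class of the net eps |-> eps^b *)
Definition eps_pow (b : R) : gennum :=
  \pi_gennum (Sub _ (eps_pow_moderate b) : moderate_net).

End Nets.
Arguments eps_pow {R}.

(* Several topologies on the same carrier have to be compared, so a topology is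
   a value, not a canonical structure of the carrier. The alias [tspace tau]
   carries the corresponding topologicalType structure. *)
Record topology (T : Type) := Topology {
  is_open : set (set T) ;
  is_openT : is_open setT ;
  is_openI : setI_closed is_open ;
  is_open_bigcup : forall D : set (set T),
    D `<=` is_open -> is_open (\bigcup_(U in D) U) }.

Definition tspace (T : Type) (tau : topology T) : Type := T.

HB.instance Definition _ (T : choiceType) (tau : topology T) :=
  Choice.copy (tspace tau) T.

Lemma is_open_bigcupT (T : Type) (tau : topology T) (I : Type) (f : I -> set T) :
  (forall i, is_open tau (f i)) -> is_open tau (\bigcup_i f i).
Proof.
move=> fo; have := @is_open_bigcup _ tau (range f).
by rewrite bigcup_image; apply => _ [i _ <-].
Qed.

HB.instance Definition _ (T : choiceType) (tau : topology T) :=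
  isOpenTopological.Build (tspace tau)
    (is_openT tau) (is_openI (t := tau)) (@is_open_bigcupT T tau).

HB.instance Definition _ (K : pzRingType) (V : lmodType K) (tau : topology V) :=
  GRing.Lmodule.copy (tspace tau) V.

Definition coarser (T : Type) (tau tau' : topology T) : Prop :=
  is_open tau `<=` is_open tau'.

Section QuotientModule.
Variables (K : pzRingType) (V : lmodType K) (M : submodClosed V).

(* The library does not derive closure under opposites, needed for the quotient
   group, from closure under scaling. *)
Definition submod_mem : V -> bool := fun u => u \in M.
HB.instance Definition _ := GRing.isZmodClosed.Build V submod_mem
  (GRing.submod_closedB (submodClosedP M)).
HB.instance Definition _ := GRing.isScaleClosed.Build K V submod_mem
  (fun a u => @rpredZ K V M a u).

Definition submod_zmod : zmodClosed V :=
  Eval hnf in GRing.ZmodClosed.clone V submod_mem _.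

Definition quotmod : Type := @Quotient.quot V submod_zmod.
HB.instance Definition _ := GRing.Zmodule.on quotmod.
HB.instance Definition _ := EqQuotient.on quotmod.

Lemma quotmod_eqE (u v : V) : (\pi_quotmod u == \pi_quotmod v) = (u - v \in M).
Proof. by rewrite -Quotient.idealrBE. Qed.

Definition quotmod_scale (a : K) (x : quotmod) : quotmod :=
  \pi_quotmod (a *: repr x).

Lemma pi_quotmodZ a (u : V) :
  \pi_quotmod (a *: u) = quotmod_scale a (\pi_quotmod u).
Proof.
apply/eqP; rewrite quotmod_eqE -scalerBr rpredZ//.
by rewrite -quotmod_eqE reprK.
Qed.

Lemma quotmod_scaleA a b x :
  quotmod_scale a (quotmod_scale b x) = quotmod_scale (a * b) x.
Proof. by rewrite -[x]reprK -(pi_quotmodZ b (repr x)) -!pi_quotmodZ scalerA. Qed.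

Lemma quotmod_scale1 : left_id 1 quotmod_scale.
Proof. by move=> x; rewrite -[x]reprK -pi_quotmodZ scale1r. Qed.

Lemma quotmod_scaleDr : right_distributive quotmod_scale +%R.
Proof.
move=> a x y; rewrite -[x]reprK -[y]reprK -(raddfD \pi_quotmod).
by rewrite -!pi_quotmodZ scalerDr raddfD.
Qed.

Lemma quotmod_scaleDl x : {morph quotmod_scale^~ x : a b / a + b}.
Proof.
by move=> a b; rewrite -[x]reprK -!pi_quotmodZ scalerDl (raddfD \pi_quotmod).
Qed.

HB.instance Definition _ := GRing.Zmodule_isLmodule.Build K quotmod
  quotmod_scaleA quotmod_scale1 quotmod_scaleDr quotmod_scaleDl.

Variable tau : topology V.

Program Definition quotient_top : topology quotmod :=
  {| is_open := [set U | is_open tau (\pi_quotmod @^-1` U)] |}.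
Next Obligation. by rewrite /= preimage_setT; exact: is_openT. Qed.
Next Obligation. by move=> A B /= oA oB; rewrite preimage_setI; exact: is_openI. Qed.
Next Obligation.
move=> D oD /=; rewrite preimage_bigcup.
rewrite -(bigcup_image D (fun U => \pi_quotmod @^-1` U) id).
by apply: is_open_bigcup => _ [U DU <-]; exact: oD.
Qed.

End QuotientModule.

Section TopologicalModules.
Variable R : realType.
Local Notation K := (gennum R).

Section OneModule.
Variable G : lmodType K.
Implicit Types (A : set G) (U : nat -> set G) (tau : topology G).

Definition linear_topology tau : Prop :=
  continuous (fun z : tspace tau * tspace tau => z.1 + z.2) /\
  continuous (fun z : K * tspace tau => z.1 *: z.2).

Definition hausdorff tau : Prop := hausdorff_space (tspace tau).

Definition balanced A : Prop :=
  forall l : K, enorm l <= 1 -> [set l *: u | u in A] `<=` A.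

Definition absorbent A : Prop :=
  forall u : G, exists a : R, forall b : R, b <= a ->
    [set eps_pow b *: v | v in A] u.

(* Strings are indexed by n >= 1; the value U 0 plays no role. *)
Definition is_string U : Prop :=
  [/\ forall n, (1 <= n)%N -> balanced (U n) /\ absorbent (U n),
      forall n, (1 <= n)%N ->
        [set u + v | u in U n.+1 & v in U n.+1] `<=` U n &
      forall n p, (1 <= n)%N -> (1 <= p)%N ->
        [set eps_pow (- n%:R) *: u | u in U (n + p)%N] `<=` U p].

Definition closed_string tau U : Prop :=
  forall n, (1 <= n)%N -> closed (U n : set (tspace tau)).

Definition topological_string tau U : Prop :=
  forall n, (1 <= n)%N -> nbhs (0 : tspace tau) (U n).

Definition barrelled tau : Prop :=
  forall U, is_string U -> closed_string tau U -> topological_string tau U.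

Definition is_assoc_barrelled tau taut : Prop :=
  [/\ linear_topology taut, barrelled taut, coarser tau taut &
      forall sigma, linear_topology sigma -> barrelled sigma ->
        coarser tau sigma -> coarser taut sigma].

(* The associated barrelled topology is determined by tau up to equality of the
   open sets; its existence is part of what [infra_s] asserts. *)
Definition infra_s tau0 : Prop :=
  [/\ linear_topology tau0, hausdorff tau0 &
      forall tau, linear_topology tau -> hausdorff tau -> coarser tau tau0 ->
        exists2 taut, is_assoc_barrelled tau taut & coarser tau0 taut].

End OneModule.

Definition s_module (G : lmodType K) (tau : topology G) : Prop :=
  [/\ linear_topology tau, hausdorff tau &
      forall M : submodClosed G, closed [set u : tspace tau | u \in M] ->
        infra_s (quotient_top M tau)].

Definition weakly_singular (G F : lmodType K) (tauG : topology G)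
    (tauF : topology F) (T : {linear G -> F}) : Prop :=
  \bigcap_(V in nbhs (0 : tspace tauF)) closure (T @^-1` V : set (tspace tauG)) =
  closure [set u : tspace tauG | T u = 0].

Definition open_map (G F : Type) (tauG : topology G) (tauF : topology F)
    (f : G -> F) : Prop :=
  forall U, is_open tauG U -> is_open tauF (f @` U).

End TopologicalModules.

(* Main.v *)
Require Import Defs.
From mathcomp Require Import all_boot all_order all_algebra.
From mathcomp Require Import all_classical all_reals all_analysis.
From HB Require Import structures.
From mathcomp Require Import generic_quotient complex.
Import Order.TTheory GRing.Theory Num.Theory.
Local Open Scope classical_set_scope.
Local Open Scope ring_scope.
Local Open Scope quotient_scope.
Set Implicit Arguments.
Unset Strict Implicit.
Unset Printing Implicit Defensive.

(** Let [M] be a closed submodule, [tau0] the quotient topology on [G / M] and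
[tau] a coarser Hausdorff linear topology. Two things are needed: the
associated barrelled topology [taut] of [tau] exists, and [tau0] is coarser
than [taut].

The second point is where the hypothesis on [G] enters. The projection of
[(G, tau1)] onto [(G / M, taut)] need not be continuous, but it is continuous
into the coarser Hausdorff topology [tau]. If [u] lies in the closure of the
preimage of every [taut]-neighborhood of [0], then every [tau]-neighborhood of
the class of [u] meets every [tau]-neighborhood of [0], so that class is [0]:
the projection is weakly singular. By hypothesis it is open into [taut], and
every [tau0]-open set, being the image of its preimage, is [taut]-open
([proposition3p38]).

For the existence of [taut] ([assoc_barrelled_exists]), take all families of
sets that can serve as a subbase at [0] of a linear topology ([zero_subbase])
and that consist of [sigma]-neighborhoods of [0] for every barrelled linear
[sigma] finer than [tau]. Their union is again such a family and generates a linear topology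
[taut], coarser than every such [sigma]. It is finer than [tau], because the
[tau]-neighborhoods of [0] are one of these families. It is barrelled, because a
[taut]-closed string is [sigma]-closed, hence [sigma]-topological, for every
such [sigma], so that its knots are one of these families too; that the knots of
a string satisfy the axioms of a subbase is [knots_zero_subbase]. *)

(** * Scaling generalized numbers into the unit ball *)

Section GeneralizedNumbers.
Variable R : realType.
Implicit Types (k l : gennum R) (b : R).

Lemma eps_powNK b : eps_pow (- b) * eps_pow b = 1 :> gennum R.
Proof.
rewrite /eps_pow -(rmorphM (\pi_(gennum R))) -(rmorph1 (\pi_(gennum R))).
congr (\pi_(gennum R) _); apply: val_inj; apply: funext => e /=.
change (((val e `^ - b)%:C)%C * ((val e `^ b)%:C)%C = 1 :> complex R).
rewrite -rmorphM -powRD ?addNr ?powRr0//=.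
by case/andP: (valP e) => /gt_eqF -> _; rewrite implybT.
Qed.

(** The valuation is a supremum that may fail to be attained; a strict bound on
the norm nevertheless makes the representative of [k] an [O(eps^-b)], and the
product an [O(1)]. *)
Lemma enorm_eps_powM b k : enorm k < expR b -> enorm (eps_pow b * k) <= 1.
Proof.
move=> kb.
have kv : ((- b)%:E < valuation k)%E.
  have := valuation_gtNy k; move: kb; rewrite /enorm.
  case: (valuation k) => [r| |]//=; last by rewrite ltry.
  by rewrite ltr_expR ltrNl lte_fin.
have H : bigO_pow (val (repr k)) (- b) by exact: valuation_gt.
have Hb : bigO_pow (fun e : eps_index R => ((val e `^ b)%:C)%C) b.
  by exists 1, 1; split=> // e _; rewrite normc_eps_pow mul1r.
have := bigO_powM Hb H; rewrite subrr => bk.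
have v0 : (0%:E <= valuation (eps_pow b * k)%R)%E.
  rewrite /eps_pow -[k in valuation (_ * k)]reprK -(rmorphM (\pi_(gennum R))).
  by rewrite valuation_pi; apply: ereal_sup_ubound; exists 0.
have := valuation_gtNy (eps_pow b * k); rewrite /enorm.
case: (valuation _) v0 => [r| |]//=; rewrite lee_fin => r0 _.
by rewrite -[leRHS]expR0 ler_expR oppr_le0.
Qed.

Lemma near_enormB l (d : R) : 0 < d -> \forall k \near l, enorm (k - l) < d.
Proof.
move=> d0; apply/nbhs_ballP; exists d => // k.
by rewrite /ball/= /mdist/= -enormN opprB.
Qed.

(** Locally the norm is bounded, hence a single power of [eps] brings all
scalars near [l] into the unit ball, where balanced sets absorb them. The
exponent is kept positive to serve as an index shift in a string. *)
Lemma near_enorm_eps_powM l :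
  exists2 n, (1 <= n)%N & \forall k \near l, enorm (eps_pow n%:R * k) <= 1.
Proof.
exists (Num.truncn (Num.max 1 (enorm l))).+1 => //.
apply: filterS (near_enormB l ltr01) => k kl; apply: enorm_eps_powM.
apply: (@lt_trans _ _ (Num.truncn (Num.max 1 (enorm l))).+1%:R); last first.
  by apply: lt_le_trans (expR_ge1Dx _); rewrite ltrDr.
rewrite -[k](subrK l); apply: le_lt_trans (enormD _ _) _.
apply: le_lt_trans (truncnS_gt _).
by rewrite ge_max !le_max (ltW kl) lexx orbT.
Qed.

End GeneralizedNumbers.

(** * Topologies as values *)

Section Topologies.
Variables (T : choiceType).
Implicit Types (tau sigma : topology T) (u : T) (A : set T).

Lemma nbhs_tspaceP tau u A :
  nbhs (u : tspace tau) A <-> exists B, [/\ is_open tau B, B u & B `<=` A].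
Proof.
rewrite nbhsE /=; split=> [[B [oB Bu] BA]|[B [oB Bu BA]]]; last by exists B.
by exists B.
Qed.

Lemma nbhs_coarser tau sigma u A : coarser tau sigma ->
  nbhs (u : tspace tau) A -> nbhs (u : tspace sigma) A.
Proof.
move=> ts /nbhs_tspaceP[B [oB Bu BA]]; apply/nbhs_tspaceP; exists B; split=> //.
exact: ts.
Qed.

Lemma is_open_nbhs tau A :
  is_open tau A <-> forall u, A u -> nbhs (u : tspace tau) A.
Proof.
split=> [oA u Au|H]; first by apply/nbhs_tspaceP; exists A; split.
by change (open (A : set (tspace tau))); rewrite openE.
Qed.

Lemma closed_coarser tau sigma A : coarser tau sigma ->
  closed (A : set (tspace tau)) -> closed (A : set (tspace sigma)).
Proof. by move=> ts; rewrite -!openC => /ts. Qed.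

End Topologies.

(** * Linear topologies from subbases at the origin *)

Section Modules.
Variables (R : realType) (G : lmodType (gennum R)).
Local Notation K := (gennum R).
Implicit Types (tau sigma : topology G) (u v : G) (A O : set G).

Section LinearTopology.
Variables (tau : topology G) (taul : linear_topology tau).

Lemma linear_nbhsD u v A : nbhs (u + v : tspace tau) A ->
  exists B C, [/\ nbhs (u : tspace tau) B, nbhs (v : tspace tau) C &
    forall x y, B x -> C y -> A (x + y)].
Proof.
move=> nA; have [[B C] /= [nB nC] H] := taul.1 (u, v) A nA.
by exists B, C; split=> // x y Bx Cy; exact: (H (x, y)).
Qed.

Lemma linear_nbhsZ (k : K) u A : nbhs (k *: u : tspace tau) A ->
  exists2 B, nbhs (u : tspace tau) B &
    \forall l \near k, forall x, B x -> A (l *: x).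
Proof.
move=> nA; have [[L B] /= [nL nB] H] := taul.2 (k, u) A nA.
by exists B => //; apply: filterS nL => l Ll x Bx; exact: (H (l, x)).
Qed.

Lemma linear_nbhs_shift u A :
  nbhs (u : tspace tau) A <-> nbhs (0 : tspace tau) [set v | A (u + v)].
Proof.
split=> [|n0].
  rewrite -[u in nbhs u]addr0 => /linear_nbhsD[B [C [nB nC H]]].
  by apply: filterS nC => v Cv; exact: (H _ _ (nbhs_singleton nB) Cv).
move: n0; rewrite -(subrr u) => /linear_nbhsD[B [C [nB nC H]]].
apply: filterS nB => x Bx; have /= := H x (- u) Bx (nbhs_singleton nC).
by rewrite addrCA subrr addr0.
Qed.

End LinearTopology.

(** Conditions on a family of sets to be a subbase at [0] of a linear topology.
Each set is only compared with members of the same family, so that the notion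
is stable under arbitrary unions. The two last fields split the continuity of
scaling at [(l, u)] along [k *: x - l *: u = k *: (x - u) + (k - l) *: u]. *)
Record zero_subbase (S : set (set G)) : Prop := ZeroSubbase {
  zero_subbase0 : forall A, S A -> A 0 ;
  zero_subbaseD : forall A, S A ->
    exists2 B, S B & forall u v, B u -> B v -> A (u + v) ;
  zero_subbaseZ : forall (l : K) A, S A ->
    exists2 B, S B & \forall k \near l, forall u, B u -> A (k *: u) ;
  zero_subbaseZ0 : forall (l : K) u A, S A -> \forall k \near l, A ((k - l) *: u)
}.

Lemma nbhs0_zero_subbase tau : linear_topology tau ->
  zero_subbase (nbhs (0 : tspace tau)).
Proof.
move=> taul; split.
- by move=> A; exact: nbhs_singleton.
- move=> A nA; have : nbhs (0 + 0 : tspace tau) A by rewrite addr0.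
  move=> /(linear_nbhsD taul)[B [C [nB nC H]]].
  by exists (B `&` C); [exact: filterI|move=> u v [Bu _] [_ Cv]; exact: H].
- by move=> l A nA; apply: (linear_nbhsZ taul); rewrite scaler0.
- move=> l u A nA.
  have : nbhs (l *: u : tspace tau) [set v | A (v - l *: u)].
    apply/(linear_nbhs_shift taul); apply: filterS nA => v /=.
    by rewrite addrAC subrr add0r.
  move=> /(linear_nbhsZ taul)[B nB].
  apply: filterS => k /(_ _ (nbhs_singleton nB)).
  by rewrite /= scalerBl.
Qed.

Definition knots (U : nat -> set G) := [set U n | n in [set n | (1 <= n)%N]].

(** The two inclusions defining a string give the conditions on sums and on
products by bounded scalars; absorbency gives the condition on small scalars. *)
Lemma knots_zero_subbase (U : nat -> set G) :
  is_string U -> zero_subbase (knots U).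
Proof.
move=> [Uba UD UZ].
have UbalancedZ n (k : K) u : (1 <= n)%N -> enorm k <= 1 -> U n u -> U n (k *: u).
  by move=> n1 k1 Unu; apply: (Uba n n1).1 k1 _ _; exists u.
split=> [_ [n n1 <-]|_ [n n1 <-]|l _ [p p1 <-]|l u _ [n n1 <-]].
- have [a /(_ a (lexx a)) [v Uv _]] := (Uba n n1).2 0.
  by rewrite -(scale0r v); apply: UbalancedZ; rewrite ?enorm0 ?ler01.
- exists (U n.+1); first by exists n.+1.
  by move=> u v Uu Uv; apply: (UD n n1); exists u => //; exists v.
  (* k *: u = eps^-n *: ((eps^n * k) *: u), with eps^n * k in the unit ball *)
- have [n n1 nl] := near_enorm_eps_powM l.
  exists (U (n + p)%N); first by exists (n + p)%N => //=; rewrite ltn_addr.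
  apply: filterS nl => k kn u Uu; apply: (UZ n p n1 p1).
  exists ((eps_pow n%:R * k) *: u); last first.
    by rewrite scalerA mulrA eps_powNK mul1r.
  by apply: UbalancedZ; rewrite ?ltn_addr.
  (* u = eps^a *: v with v in U n, and (k - l) * eps^a is in the unit ball *)
- have [a /(_ a (lexx a)) [v Uv <-]] := (Uba n n1).2 u.
  apply: filterS (near_enormB l (expR_gt0 a)) => k kl; rewrite scalerA.
  by apply: UbalancedZ => //; rewrite mulrC enorm_eps_powM.
Qed.

Lemma zero_subbase_bigcup (D : set (set (set G))) :
  D `<=` zero_subbase -> zero_subbase (\bigcup_(S in D) S).
Proof.
move=> DS; split=> [A|A|l A|l u A] [S DSS SA].
- exact: (zero_subbase0 (DS S DSS)).
- by have [B SB H] := zero_subbaseD (DS S DSS) SA; exists B => //; exists S.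
- by have [B SB H] := zero_subbaseZ (DS S DSS) l SA; exists B => //; exists S.
- exact: (zero_subbaseZ0 (DS S DSS)).
Qed.

Inductive meets (S : set (set G)) : set (set G) :=
| meetsT : meets S setT
| meets_mem A : S A -> meets S A
| meetsI A B : meets S A -> meets S B -> meets S (A `&` B).

Lemma meets_zero_subbase S : zero_subbase S -> zero_subbase (meets S).
Proof.
move=> SP; split=> [A|A|l A|l u A] mA; elim: mA => {A}[|A SA|A B _ IA _ IB].
- by [].
- exact: zero_subbase0 SA.
- by split.
- by exists setT; [exact: meetsT|].
- by have [B SB H] := zero_subbaseD SP SA; exists B => //; exact: meets_mem.
- have [A' mA' HA] := IA; have [B' mB' HB] := IB; exists (A' `&` B').
    exact: meetsI.
  by move=> u v [Au Bu] [Av Bv]; split; [exact: HA|exact: HB].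
- exists setT; [exact: meetsT|by near=> k].
- by have [B SB H] := zero_subbaseZ SP l SA; exists B => //; exact: meets_mem.
- have [A' mA' HA] := IA; have [B' mB' HB] := IB; exists (A' `&` B').
    exact: meetsI.
  apply: filterS2 HA HB => k HA HB u [Au Bu].
  by split; [exact: HA|exact: HB].
- by near=> k.
- exact: (zero_subbaseZ0 SP).
- exact: filterS2 IA IB.
Unshelve. all: by end_near.
Qed.

Program Definition subbase_top (S : set (set G)) : topology G := {|
  is_open := [set O | forall u, O u ->
    exists2 A, meets S A & forall v, A v -> O (u + v)] |}.
Next Obligation. by move=> S u _; exists setT => //; exact: meetsT. Qed.
Next Obligation.
move=> S O P HO HP u [/HO[A SA AO] /HP[B SB BP]]; exists (A `&` B).
  exact: meetsI.
by move=> v [/AO ? /BP].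
Qed.
Next Obligation.
move=> S D HD u [P DP /(HD P DP)[A SA AP]]; exists A => // v /AP.
by exists P.
Qed.

(** Halving, the condition on sums, is what makes the points having a translated
basic set inside [O] an open set. *)
Lemma nbhs_subbase_top (S : set (set G)) u O : zero_subbase S ->
  nbhs (u : tspace (subbase_top S)) O <->
  exists2 A, meets S A & forall v, A v -> O (u + v).
Proof.
move=> /meets_zero_subbase SP; split.
  by move=> /nbhs_tspaceP[P [oP /oP[A SA AP] PO]]; exists A => // v /AP /PO.
move=> [A SA AO]; apply/nbhs_tspaceP.
exists [set w | exists2 B, meets S B & forall v, B v -> O (w + v)]; split.
- move=> w /= [B /(zero_subbaseD SP)[C SC CB] BO]; exists C => // x Cx.
  by exists C => // y Cy; rewrite -addrA; apply/BO/CB.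
- by exists A.
- by move=> w [B SB /(_ 0 (zero_subbase0 SP SB))]; rewrite addr0.
Qed.

Lemma subbase_top_linear (S : set (set G)) : zero_subbase S ->
  linear_topology (subbase_top S).
Proof.
move=> SP; have mP := meets_zero_subbase SP.
have nbhsP := fun u O => nbhs_subbase_top u O SP.
split.
- move=> [u v] O /= /nbhsP[A SA AO].
  have [B SB BA] := zero_subbaseD mP SA.
  exists ([set x | B (x - u)], [set x | B (x - v)]) => /=.
    split; apply/nbhsP; exists B => // w.
      by rewrite /= addrAC subrr add0r.
    by rewrite /= addrAC subrr add0r.
  move=> [x y] /= [Bx By]; have := AO _ (BA _ _ Bx By).
  by rewrite addrACA subrKC subrKC.
- move=> [l u] O /= /nbhsP[A SA AO].
  have [B SB BA] := zero_subbaseD mP SA.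
  have [C SC CB] := zero_subbaseZ mP l SB.
  have lB := zero_subbaseZ0 mP l u SB.
  exists ([set k | (forall v, C v -> B (k *: v)) /\ B ((k - l) *: u)],
          [set x | C (x - u)]) => /=.
    split; first exact: filterI.
    by apply/nbhsP; exists C => // w; rewrite /= addrAC subrr add0r.
  move=> [k x] /= [[/(_ (x - u)) kC Bkl] Cx].
  have := AO _ (BA _ _ (kC Cx) Bkl).
  by rewrite scalerBr scalerBl subrKA subrKC.
Qed.

(** * The associated barrelled topology *)

Definition barrelled_above tau : set (topology G) :=
  [set sigma | [/\ linear_topology sigma, barrelled sigma & coarser tau sigma]].

(** The whole union is taken, rather than the neighborhoods of [0] common to all
the [sigma], because the latter need not form a [zero_subbase]: the set halving
a given one may depend on [sigma]. *)
Definition assoc_subbase tau : set (set G) :=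
  \bigcup_(S in [set S | zero_subbase S /\ forall sigma,
    barrelled_above tau sigma -> S `<=` nbhs (0 : tspace sigma)]) S.

Lemma assoc_zero_subbase tau : zero_subbase (assoc_subbase tau).
Proof. by apply: zero_subbase_bigcup => S []. Qed.

(** When no barrelled topology lies above [tau], the family of constraints is
empty and the argument still applies: it then produces one. *)
Lemma assoc_barrelled_exists tau : linear_topology tau ->
  is_assoc_barrelled tau (subbase_top (assoc_subbase tau)).
Proof.
move=> taul; set S := assoc_subbase tau.
have SP : zero_subbase S := assoc_zero_subbase tau.
have Smin sigma : barrelled_above tau sigma -> coarser (subbase_top S) sigma.
  move=> sP; have [sl _ _] := sP.
  move=> O oO; apply/is_open_nbhs => u /oO[A SA AO].
  apply/(linear_nbhs_shift sl); apply: filterS AO _.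
  elim: SA => {A}[|A [S' [_ S's] S'A]|A B _ nA _ nB].
  - exact: filterT.
  - exact: (S's sigma).
  - exact: filterI.
split.
- exact: subbase_top_linear.
- move=> U sU cU n n1; apply/(nbhs_subbase_top _ _ SP); exists (U n); last first.
    by move=> v; rewrite add0r.
  apply: meets_mem; exists (knots U); last by exists n.
  split; first exact: knots_zero_subbase.
  move=> sigma sP _ [m m1 <-]; have [_ sb _] := sP.
  apply: sb => // p p1; apply: closed_coarser (cU p p1).
  exact: Smin.
- move=> O oO u Ou; exists [set v | O (u + v)] => //.
  apply: meets_mem; exists (nbhs (0 : tspace tau)).
    split; first exact: nbhs0_zero_subbase.
    by move=> sigma [_ _ ts] A; exact: nbhs_coarser.
  apply: (linear_nbhs_shift taul u O).1.
  exact: (is_open_nbhs tau O).1 oO u Ou.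
- by move=> sigma sl sb ts; apply: Smin.
Qed.

(** * Quotient modules *)

Section Quotient.
Variables (tau : topology G) (M : submodClosed G).
Local Notation H := (quotmod M).
Local Notation p := (\pi_H).

(** A named copy of the projection, to carry its structure of linear map. *)
Definition quotmod_pi (u : G) : H := p u.

Lemma quotmod_pi_linear : linear quotmod_pi.
Proof. by move=> k u v; rewrite /quotmod_pi raddfD /= pi_quotmodZ. Qed.

HB.instance Definition _ :=
  GRing.isLinear.Build K G H *:%R quotmod_pi quotmod_pi_linear.

Lemma quotmod_piE (u v : G) : quotmod_pi u = quotmod_pi v <-> u - v \in M.
Proof. by rewrite -quotmod_eqE; split=> [/eqP|/eqP]. Qed.

Lemma quotmod_pi_surj (x : H) : exists u, quotmod_pi u = x.
Proof. by exists (repr x); rewrite /quotmod_pi reprK. Qed.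

Hypothesis taul : linear_topology tau.

(** The saturation of an open set is a union of its translates by elements of
the submodule. *)
Lemma quotmod_pi_open : open_map tau (quotient_top M tau) quotmod_pi.
Proof.
move=> O oO; apply/(is_open_nbhs tau) => u [v Ov vu].
apply/(linear_nbhs_shift taul).
have /(linear_nbhs_shift taul) := (is_open_nbhs tau O).1 oO v Ov.
apply: filterS => w /= Ovw; exists (v + w) => //.
by rewrite raddfD /= vu -raddfD.
Qed.

Lemma nbhs_quotient_top u (A : set H) :
  nbhs (quotmod_pi u : tspace (quotient_top M tau)) A <->
  nbhs (u : tspace tau) (quotmod_pi @^-1` A).
Proof.
split=> /nbhs_tspaceP[B [oB Bu BA]]; apply/nbhs_tspaceP.
  by exists (quotmod_pi @^-1` B); split=> // v /BA.
exists (quotmod_pi @` B); split; first exact: quotmod_pi_open.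
  by exists u.
by move=> _ [v /BA Av <-].
Qed.

Lemma nbhs_quotmod_pi_image u A : nbhs (u : tspace tau) A ->
  nbhs (quotmod_pi u : tspace (quotient_top M tau)) (quotmod_pi @` A).
Proof.
by move=> nA; apply/nbhs_quotient_top; apply: filterS nA => v Av; exists v.
Qed.

Lemma quotient_top_linear : linear_topology (quotient_top M tau).
Proof.
split.
- move=> [x y] A /=.
  have [u <-] := quotmod_pi_surj x; have [v <-] := quotmod_pi_surj y.
  rewrite -raddfD => /nbhs_quotient_top /(linear_nbhsD taul)[B [C [nB nC BCA]]].
  exists (quotmod_pi @` B, quotmod_pi @` C) => /=.
    by split; exact: nbhs_quotmod_pi_image.
  move=> [_ _] /= [[b Bb <-] [c Cc <-]]; rewrite -raddfD; exact: BCA.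
- move=> [k x] A /=; have [u <-] := quotmod_pi_surj x.
  rewrite -linearZ => /nbhs_quotient_top /(linear_nbhsZ taul)[B nB BA].
  exists ([set l | forall x, B x -> (quotmod_pi @^-1` A) (l *: x)],
          quotmod_pi @` B) => /=.
    by split=> //; exact: nbhs_quotmod_pi_image.
  move=> [l _] /= [lB [b Bb <-]]; rewrite -linearZ; exact: lB.
Qed.

(** If [u - v] avoids the closed set [M], so does [x - y] for [x] near [u] and
[y] near [v], and the images of these neighborhoods are disjoint. *)
Lemma quotient_top_hausdorff :
  closed [set u : tspace tau | u \in M] -> hausdorff (quotient_top M tau).
Proof.
move=> cM x y; have [u <-] := quotmod_pi_surj x.
have [v <-] := quotmod_pi_surj y.
move=> clxy; apply/quotmod_piE; rewrite -[_ \in M]negbK; apply/negP => uvM.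
have : nbhs (u + (-1) *: v : tspace tau) [set w | w \notin M].
  apply/nbhs_tspaceP; exists [set w | w \notin M]; split=> //; last first.
    by rewrite /= scaleN1r.
  move: cM; rewrite -openC; congr (is_open tau _).
  by apply/seteqP; split=> w /= /negP.
move=> /(linear_nbhsD taul)[B [C [nB nC BC]]].
have [D nD /nbhs_singleton /= DC] := linear_nbhsZ taul nC.
have [_ [[b Bb <-] [d Dd]]] :=
  clxy _ _ (nbhs_quotmod_pi_image nB) (nbhs_quotmod_pi_image nD).
move=> /quotmod_piE dbM; have /= := BC _ _ Bb (DC _ Dd).
by rewrite scaleN1r -opprB -[- _]scaleN1r rpredZ.
Qed.

End Quotient.
End Modules.

(** * Modules with the open mapping property *)

Theorem proposition3p38 (R : realType) (G : lmodType (gennum R))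
    (tau1 : topology G) :
  linear_topology tau1 -> hausdorff tau1 ->
  (forall (F : lmodType (gennum R)) (tauF : topology F) (T : {linear G -> F}),
     linear_topology tauF -> barrelled tauF ->
     weakly_singular tau1 tauF T -> range T = [set: F] ->
     open_map tau1 tauF T) ->
  s_module tau1.
Proof.
move=> lin1 haus1 opn; split=> // M cM; split.
- exact: quotient_top_linear.
- exact: quotient_top_hausdorff.
move=> tau taul tauh tau_coarser.
pose taut := subbase_top (assoc_subbase tau).
have tautP : is_assoc_barrelled tau taut by exact: assoc_barrelled_exists.
have [tautl tautb tau_taut _] := tautP.
exists taut => // O oO.
have pi_open : open_map tau1 taut (quotmod_pi M).
  apply: opn => //; last first.
    by apply/seteqP; split=> // x _; have [u <-] := quotmod_pi_surj x; exists u.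
  apply/seteqP; split=> [u clu|u clu V nV].
    (* The class of u is a cluster point of the tau-neighborhoods of 0. *)
    apply: subset_closure => /=; symmetry; apply: tauh => A B nA nB.
    have [v [Av Bv]] := clu A (nbhs_coarser tau_taut nA) _
      ((nbhs_quotient_top lin1 u B).1 (nbhs_coarser tau_coarser nB)).
    by exists (quotmod_pi M v).
  apply: closureS clu => v /= v0; rewrite /preimage /= v0.
  exact: (nbhs_singleton nV).
(* The set O is open in the quotient topology: its preimage is open in G. *)
have := pi_open _ oO.
congr (is_open taut _); apply/seteqP; split=> [_ [u Ou <-]//|x Ox].
have [u ux] := quotmod_pi_surj x.
by exists u => //=; rewrite -/(quotmod_pi M u) ux.
Qed.
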